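(* Let $K$ be a field, $S=K[x_1,\ldots,x_n]$, and let $I\subset S$ be an ideal generated by quadratic monomials, with minimal monomial generators $u_1,\ldots,u_m$. Suppose $I$ satisfies: $( * )$ if $x_ix_j\in I$ with $i\ne j$, and $k>i$, $k>j$, then $x_ix_k\in I$ or $x_jx_k\in I$; $( ** )$ if $x_i^2\in I$ and $j>i$ is such that there exists $k$ with $x_kx_j\in I$, then $x_ix_j\in I$ or $x_ix_k\in I$. Let $T=S[y_1,\ldots,y_m]$, let $\phi\colon T\to R(I)=S[u_1t,\ldots,u_mt]\subset S[t]$ be given by $\phi(x_i)=x_i$, $\phi(y_j)=u_jt$, and let $P=\ker\phi$. Then there exists a lexicographic order $<_{lex}$ on $T$ such that the reduced Gröbner basis of $P$ with respect to $<_{lex}$ consists of binomials $f\in T$ with $\deg_x(f)\le 1$.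
   Context: For $f\in T$, $\deg_x(f)$ is the maximum over the monomials $x^ay^b$ of $f$ of the total degree $|a|$ in $x_1,\ldots,x_n$. $R(I)$ is the Rees algebra of $I$. *)

(* Defs.v *)
From HB Require Import structures.
From mathcomp Require Import all_boot all_order all_algebra all_fingroup.
From mathcomp Require Import mpoly.
Set Implicit Arguments. Unset Strict Implicit. Unset Printing Implicit Defensive.
Import Order.TTheory GRing.Theory.
Local Open Scope ring_scope.

Definition in_ideal_gen (K : fieldType) (n m : nat)
  (gens : 'I_m -> {mpoly K[n]}) (p : {mpoly K[n]}) : Prop :=
  exists c : 'I_m -> {mpoly K[n]}, p = \sum_(j < m) c j * gens j.

Definition in_monideal (K : fieldType) (n m : nat)
  (u : 'I_m -> 'X_{1..n}) (p : {mpoly K[n]}) : Prop :=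
  in_ideal_gen (fun j => 'X_[u j]) p.

(* T = S[y_1..y_m] = K[x_1..x_n,y_1..y_m], variables indexed by 'I_(n+m):
   x_i is 'X_(lshift m i), y_j is 'X_(rshift n j).
   S[t] = K[x_1..x_n,t], variables indexed by 'I_(n.+1): x_i is
   'X_(widen_ord _ i), t is 'X_(ord_max). *)

Definition S_to_St (K : fieldType) (n : nat) (p : {mpoly K[n]}) : {mpoly K[n.+1]} :=
  p \mPo [tuple ('X_(widen_ord (leqnSn n) i) : {mpoly K[n.+1]}) | i < n].

Definition rees_image (K : fieldType) (n m : nat) (u : 'I_m -> 'X_{1..n})
  (i : 'I_(n + m)) : {mpoly K[n.+1]} :=
  match split i with
  | inl a => 'X_(widen_ord (leqnSn n) a)
  | inr b => S_to_St ('X_[u b]) * 'X_(ord_max)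
  end.

Definition rees_phi (K : fieldType) (n m : nat) (u : 'I_m -> 'X_{1..n})
  (f : {mpoly K[n + m]}) : {mpoly K[n.+1]} :=
  f \mPo [tuple @rees_image K n m u i | i < n + m].

Definition rees_kernel (K : fieldType) (n m : nat) (u : 'I_m -> 'X_{1..n})
  (f : {mpoly K[n + m]}) : Prop := @rees_phi K n m u f = 0.

(* The lexicographic order on monomials of K[z_0..z_(N-1)] determined by the
   ordering of the variables z_(s 0) > z_(s 1) > ... > z_(s (N-1)).
   Every lexicographic order arises this way for some permutation s. *)
Definition lex_lt (N : nat) (s : 'S_N) (a b : 'X_{1..N}) : Prop :=
  exists k : 'I_N, (a (s k) < b (s k))%N /\
    forall l : 'I_N, (l < k)%N -> a (s l) = b (s l).

Definition lex_le (N : nat) (s : 'S_N) (a b : 'X_{1..N}) : Prop :=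
  a = b \/ lex_lt s a b.

Definition is_lead_mon (K : fieldType) (N : nat) (s : 'S_N)
  (f : {mpoly K[N]}) (mon : 'X_{1..N}) : Prop :=
  mon \in msupp f /\ forall mon', mon' \in msupp f -> lex_le s mon' mon.

Definition mdivides (N : nat) (a b : 'X_{1..N}) : Prop :=
  forall i : 'I_N, (a i <= b i)%N.

Definition is_groebner (K : fieldType) (N : nat) (s : 'S_N)
  (P : {mpoly K[N]} -> Prop) (G : seq {mpoly K[N]}) : Prop :=
  (forall g, g \in G -> P g /\ g != 0) /\
  (forall f, P f -> f != 0 ->
     exists g, g \in G /\
       exists a b, is_lead_mon s g a /\ is_lead_mon s f b /\ mdivides a b).

Definition is_reduced_groebner (K : fieldType) (N : nat) (s : 'S_N)
  (P : {mpoly K[N]} -> Prop) (G : seq {mpoly K[N]}) : Prop :=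
  is_groebner s P G /\ uniq G /\
  (forall g, g \in G -> exists a, is_lead_mon s g a /\ g@_a = 1) /\
  (forall g g', g \in G -> g' \in G -> g != g' ->
     forall a, is_lead_mon s g' a ->
       forall mon, mon \in msupp g -> ~ mdivides a mon).

Definition is_binomial (K : fieldType) (N : nat) (f : {mpoly K[N]}) : Prop :=
  size (msupp f) = 2%N.

Definition deg_x (K : fieldType) (n m : nat) (f : {mpoly K[n + m]}) : nat :=
  \max_(mon <- msupp f) (\sum_(i < n) mon (lshift m i))%N.

(* Main.v *)
Require Import Defs.
From HB Require Import structures.
From mathcomp Require Import all_boot all_order all_algebra all_fingroup.
From mathcomp Require Import mpoly zify.
From Stdlib Require Import Classical IndefiniteDescription.
Import Order.TTheory GRing.Theory.
Local Open Scope ring_scope.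

Set Implicit Arguments. Unset Strict Implicit. Unset Printing Implicit Defensive.

(** Write [w ~ w'] when two monomials of T have the same image under phi.
   A monomial is a leading monomial of P exactly when it is nonstandard, i.e.
   [w ~ w'] for some smaller [w'], and the reduced Groebner basis consists of
   the differences [w - nf w], with [w] minimal nonstandard and [nf w] the least
   monomial equivalent to [w].  As [~] preserves the x-degree, it suffices that
   every nonstandard monomial has a nonstandard divisor of x-degree at most 1.

   View [y_j] with [u_j = x_p x_q] as an edge {p,q} and [x_i] as an edge from i
   to an extra vertex.  Take the lexicographic order with first the loops [y_pp]
   (p increasing), then the edges {p,q}, p < q, lexicographically, then the x's.
   Let [w ~ w'] be without common factor, let [z] be the largest variable of
   [w] (it exceeds every variable of [w']), and let [x_i | w].  Some [y_l | w'] is an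
   edge {i,k}.  An alternating trail leaving i through {i,k}, with edges taken
   from [w'] and [w] in turn, returns to the extra vertex; unless it directly
   gives the divisor, it gives [x_j r ~ x_k b] with [x_j r z | w] and [b | w'].
   If [z] is the edge {a,c} and {a,k} is a smaller edge of I, then
   [x_j r z ~ x_c b y_ak] is the required relation.  The same holds with i in
   place of k, and conditions star and star2 supply an edge for which this applies. *)

(** * Monomial divisibility and comparison in the lexicographic order *)

Lemma lepm_addU N (a w : 'X_{1..N}) (z : 'I_N) :
  (a <= w)%MM -> (a z < w z)%N -> (a + U_(z) <= w)%MM.
Proof.
move=> /mnm_lepP h hz; apply/mnm_lepP => t; rewrite mnmDE mnm1E.
case: eqP => [<-|_]; last by rewrite addn0.
by rewrite addn1.
Qed.

Lemma lex_lt_at N (s : 'S_N) (a b : 'X_{1..N}) (z : 'I_N) :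
  (a z < b z)%N ->
  (forall t, ((s^-1)%g t < (s^-1)%g z)%N -> a t = b t) -> lex_lt s a b.
Proof.
move=> hz h; exists ((s^-1)%g z); rewrite permKV; split=> // l hl.
by apply: h; rewrite permK.
Qed.

Lemma lex_lt_addr N (s : 'S_N) (a b c : 'X_{1..N}) :
  lex_lt s (a + c)%MM (b + c)%MM <-> lex_lt s a b.
Proof.
split=> -[k [hk h]]; exists k; split.
- by move: hk; rewrite !mnmDE ltn_add2r.
- by move=> l /h; rewrite !mnmDE => /addIn.
- by rewrite !mnmDE ltn_add2r.
- by move=> l /h; rewrite !mnmDE => ->.
Qed.

(** * Fibres of phi on monomials *)

Section Fibers.
Context (n m : nat) (u : 'I_m -> 'X_{1..n}).
Implicit Types (w d : 'X_{1..n + m}).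
Local Notation x_ i := (U_(lshift m i))%MM.
Local Notation y_ j := (U_(rshift n j))%MM.

(** The exponent of x_v in phi(w), that is, the degree of the vertex v in the multigraph w; [ydeg]
    is the exponent of t. *)
Definition vdeg w (v : 'I_n) : nat :=
  (w (lshift m v) + \sum_(j < m) w (rshift n j) * u j v)%N.
Definition ydeg w : nat := (\sum_(j < m) w (rshift n j))%N.
Definition xdeg w : nat := (\sum_(i < n) w (lshift m i))%N.
Definition fiber_eq w w' : Prop :=
  (forall v, vdeg w v = vdeg w' v) /\ ydeg w = ydeg w'.

Lemma vdegD w w' v : vdeg (w + w')%MM v = (vdeg w v + vdeg w' v)%N.
Proof.
rewrite /vdeg mnmDE addnACA -big_split /=; congr (_ + _)%N.
by apply: eq_bigr => j _; rewrite mnmDE mulnDl.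
Qed.

Lemma ydegD w w' : ydeg (w + w')%MM = (ydeg w + ydeg w')%N.
Proof. by rewrite /ydeg -big_split /=; apply: eq_bigr => j _; rewrite mnmDE. Qed.

Lemma xdegD w w' : xdeg (w + w')%MM = (xdeg w + xdeg w')%N.
Proof. by rewrite /xdeg -big_split /=; apply: eq_bigr => j _; rewrite mnmDE. Qed.

Lemma vdegX i v : vdeg (x_ i) v = (i == v).
Proof.
rewrite /vdeg mnm1E (inj_eq (@lshift_inj _ _)) big1 ?addn0 // => j _.
by rewrite mnm1E eq_lrshift.
Qed.

Lemma vdegY j v : vdeg (y_ j) v = u j v.
Proof.
rewrite /vdeg mnm1E eq_rlshift add0n (bigD1 j) //= mnm1E eqxx mul1n big1 ?addn0 //.
by move=> l /negbTE h; rewrite mnm1E (inj_eq (@rshift_inj _ _)) eq_sym h.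
Qed.

Lemma vdeg0 v : vdeg 0%MM v = 0%N.
Proof. by rewrite /vdeg mnm0E big1 // => j _; rewrite mnm0E. Qed.

Lemma ydegX i : ydeg (x_ i) = 0%N.
Proof. by rewrite /ydeg big1 // => j _; rewrite mnm1E eq_lrshift. Qed.

Lemma ydegY j : ydeg (y_ j) = 1%N.
Proof.
rewrite /ydeg (bigD1 j) //= mnm1E eqxx big1 ?addn0 //.
by move=> l /negbTE h; rewrite mnm1E (inj_eq (@rshift_inj _ _)) eq_sym h.
Qed.

Lemma ydeg0 : ydeg 0%MM = 0%N.
Proof. by rewrite /ydeg big1 // => j _; rewrite mnm0E. Qed.

Lemma xdegX i : xdeg (x_ i) = 1%N.
Proof.
rewrite /xdeg (bigD1 i) //= mnm1E eqxx big1 ?addn0 //.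
by move=> l /negbTE h; rewrite mnm1E (inj_eq (@lshift_inj _ _)) eq_sym h.
Qed.

Lemma xdegY j : xdeg (y_ j) = 0%N.
Proof. by rewrite /xdeg big1 // => i _; rewrite mnm1E eq_rlshift. Qed.

Lemma xdeg0 : xdeg 0%MM = 0%N.
Proof. by rewrite /xdeg big1 // => j _; rewrite mnm0E. Qed.

Definition degE := (vdegD, ydegD, xdegD, vdegX, ydegX, xdegX, vdegY, ydegY, xdegY,
  vdeg0, ydeg0, xdeg0).

Lemma vdeg_gt0 w v : (0 < vdeg w v)%N ->
  exists2 z, (0 < w z)%N & (z = lshift m v \/ exists2 j, z = rshift n j & (0 < u j v)%N).
Proof.
rewrite /vdeg addn_gt0 => /orP[h|]; first by exists (lshift m v) => //; left.
rewrite lt0n sum_nat_eq0 negb_forall => /existsP[j].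
rewrite /= -lt0n muln_gt0 => /andP[h1 h2].
by exists (rshift n j) => //; right; exists j.
Qed.

Lemma lepm_vdeg w w' v : (w <= w')%MM -> (vdeg w v <= vdeg w' v)%N.
Proof. by move=> /submK <-; rewrite vdegD leq_addl. Qed.

(** One move of a trail: spare degree at v means that the quotient of [w'] by [w] contains a
    variable incident to v. Multiplicities are respected. *)
Lemma vdeg_lt w w' v : (w <= w')%MM -> (vdeg w v < vdeg w' v)%N ->
  exists2 z, (w + U_(z) <= w')%MM &
    (z = lshift m v \/ exists2 j, z = rshift n j & (0 < u j v)%N).
Proof.
move=> h; rewrite -{1}(submK h) vdegD -{1}[vdeg w v]add0n ltn_add2r => /vdeg_gt0[z hz hv].
exists z => //; apply: lepm_addU => //; by move: hz; rewrite mnmBE subn_gt0.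
Qed.

(** Handshake count, each u_j having degree 2. It makes the x-degree, and then the total degree,
    constant on fibres. *)
Lemma vdeg_sum w : (forall j, mdeg (u j) = 2%N) ->
  (\sum_v vdeg w v = xdeg w + 2 * ydeg w)%N.
Proof.
move=> hu; rewrite /vdeg big_split /=; congr (_ + _)%N.
rewrite exchange_big /= /ydeg big_distrr /=; apply: eq_bigr => j _.
by rewrite -big_distrr /= mulnC -mdegE hu.
Qed.

Lemma fiber_xdeg w w' : (forall j, mdeg (u j) = 2%N) ->
  fiber_eq w w' -> xdeg w = xdeg w'.
Proof.
move=> hu [hv hy]; have := vdeg_sum w hu.
rewrite (eq_bigr (vdeg w') (fun v _ => hv v)) (vdeg_sum w' hu) hy.
by move/addIn.
Qed.

Lemma fiber_addr w w' d : fiber_eq (w + d)%MM (w' + d)%MM <-> fiber_eq w w'.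
Proof.
split=> -[hv hy]; split=> [v|].
- by have := hv v; rewrite !vdegD => /addIn.
- by move: hy; rewrite !ydegD => /addIn.
- by rewrite !vdegD hv.
- by rewrite !ydegD hy.
Qed.

Lemma fiber_sub w w' d d' : (d <= w)%MM -> (d' <= w')%MM -> fiber_eq w w' ->
  fiber_eq d d' -> fiber_eq (w - d)%MM (w' - d')%MM.
Proof.
move=> h h' [hv hy] [dv dy]; split=> [v|].
  by have := hv v; rewrite -{1}(submK h) -{1}(submK h') !vdegD dv; lia.
by move: hy; rewrite -{1}(submK h) -{1}(submK h') !ydegD dy; lia.
Qed.

Lemma fiber_mdeg w w' : (forall j, mdeg (u j) = 2%N) ->
  fiber_eq w w' -> mdeg w = mdeg w'.
Proof.
move=> hu h; have hx := fiber_xdeg hu h.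
rewrite !mdegE !big_split_ord /= -/(xdeg w) -/(xdeg w') -/(ydeg w) -/(ydeg w').
by rewrite hx h.2.
Qed.

Context (s : 'S_(n + m)).

Definition nonstandard w := exists2 w', fiber_eq w w' & lex_lt s w' w.

Lemma nonstandard_mul d w : (d <= w)%MM -> nonstandard d -> nonstandard w.
Proof.
move=> h [d' hf hl]; exists (d' + (w - d))%MM.
  by rewrite -{1}(submK h) [(w - d + d)%MM]addmC; apply/fiber_addr.
by rewrite -{2}(submK h) [(w - d + d)%MM]addmC; apply/lex_lt_addr.
Qed.

End Fibers.

(** * Numerical keys that order the edges *)

(* Position of the edge {p,q} in the order of the variables, the largest variable
   first; [n] separates the loops from the other edges. *)
Definition edge_key n (p q : 'I_n) : nat :=
  if p == q then p : nat else (n + minn p q * n + maxn p q)%N.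

Lemma edge_keyC n (p q : 'I_n) : edge_key p q = edge_key q p.
Proof. by rewrite /edge_key eq_sym minnC maxnC; case: eqP => // ->. Qed.

Lemma edge_key_loop n (p : 'I_n) : edge_key p p = p.
Proof. by rewrite /edge_key eqxx. Qed.

Lemma edge_key_loop_lt n (p a b : 'I_n) : a != b -> (edge_key p p < edge_key a b)%N.
Proof.
move=> /negbTE h; rewrite edge_key_loop /edge_key h.
by apply: leq_trans (ltn_ord p) _; rewrite -addnA leq_addr.
Qed.

(** Keys of non-loops compare as the pairs (min, max) do lexicographically, because every maximum is
    below the multiplier [n]. *)
Lemma edge_key_le n (p q i k : 'I_n) : (p < q)%N -> i != k ->
  (edge_key p q <= edge_key i k)%N -> (p <= i)%N /\ (i = p -> (q <= k)%N).
Proof.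
move=> hpq hik; have hne : p != q by rewrite neq_ltn hpq.
rewrite /edge_key (negbTE hne) (negbTE hik) (minn_idPl (ltnW hpq)) (maxn_idPr (ltnW hpq)).
have := ltn_ord p; have := ltn_ord q; have := ltn_ord i; have := ltn_ord k.
move: hik; rewrite neq_ltn /= => hik hk hi hq hp.
case/orP: hik => hik.
  rewrite (minn_idPl (ltnW hik)) (maxn_idPr (ltnW hik)) => h; split; last by move=> e; rewrite e in h; lia.
  (* If [i < p] then [(i + 1) * n <= p * n], and [k < n] makes the key of {i,k} too small. *)
  by rewrite leqNgt; apply/negP => hlt; move: (leq_mul hlt (leqnn n)); rewrite mulSn; lia.
rewrite (minn_idPr (ltnW hik)) (maxn_idPl (ltnW hik)) => h.
have hpk : (p <= k)%N.
  by rewrite leqNgt; apply/negP => hlt; move: (leq_mul hlt (leqnn n)); rewrite mulSn; lia.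
split; first lia.
by move=> e; rewrite e in h hik; lia.
Qed.

Lemma edge_key_lt n (a b k : 'I_n) : a != b -> a != k -> (b < k)%N ->
  (edge_key a b < edge_key a k)%N.
Proof.
move=> hab hak hbk; rewrite /edge_key (negbTE hab) (negbTE hak).
have := ltn_ord a; have := ltn_ord b; have := ltn_ord k.
move: hab hak; rewrite !neq_ltn /= => hab hak hk hb ha.
case: (leqP a b) => h1; case: (leqP a k) => h2; try lia.
  have : (b.+1 * n <= a * n)%N by rewrite leq_mul.
  by rewrite mulSn; lia.
have : (b.+1 * n <= k * n)%N by rewrite leq_mul.
by rewrite mulSn; lia.
Qed.

Lemma mnm_edge_other n (v a b : 'I_n) : (0 < (U_(a) + U_(b))%MM v)%N ->
  exists v', (U_(a) + U_(b) = U_(v) + U_(v'))%MM.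
Proof.
rewrite mnmDE !mnm1E; case: eqP => [<- _|_]; first by exists b.
by case: eqP => // <- _; exists a; rewrite addmC.
Qed.

(** * Nonstandard divisors of x-degree at most 1 *)

Section Core.
Context (n m : nat) (u : 'I_m -> 'X_{1..n}).
Implicit Types (w d r b : 'X_{1..n + m}).
Local Notation x_ i := (U_(lshift m i))%MM.
Local Notation y_ j := (U_(rshift n j))%MM.
Local Notation vdeg := (vdeg u).
Local Notation fiber_eq := (fiber_eq u).

Definition edge (p q : 'I_n) : Prop := exists j, u j = (U_(p) + U_(q))%MM.

Lemma edgeC p q : edge p q -> edge q p.
Proof. by case=> j h; exists j; rewrite addmC. Qed.

Context (s : 'S_(n + m)) (key : 'I_(n + m) -> nat).
Local Notation nonstandard := (nonstandard u s).
Local Notation pos z := ((s^-1)%g z).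

Context (hquad : forall j, exists p q, u j = (U_(p) + U_(q))%MM).
Context (hinj : injective u).
Context (key_y : forall j p q, u j = (U_(p) + U_(q))%MM -> key (rshift n j) = edge_key p q).
Context (key_x : forall i j, (key (rshift n j) < key (lshift m i))%N).
Context (key_s : forall k l : 'I_(n + m), (k <= l)%N -> (key (s k) <= key (s l))%N).
Context (star : forall i j k : 'I_n, i != j -> (i < k)%N -> (j < k)%N ->
  edge i j -> edge i k \/ edge j k).
Context (star2 : forall i j k : 'I_n, edge i i -> (i < j)%N -> edge k j ->
  edge i j \/ edge i k).

(** A smaller key means a larger variable, since [s] lists the variables by nondecreasing key. Keys
    may tie, so the comparison must be strict. *)
Lemma key_pos t t' : (key t < key t')%N -> (pos t < pos t')%N.
Proof.
by move=> h; rewrite ltnNge; apply/negP => /key_s; rewrite !permKV leqNgt h.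
Qed.

Section Step.
Context (w w' : 'X_{1..n + m}) (j1 : 'I_m).
Local Notation z1 := (rshift n j1).
Local Notation after t := (pos z1 < pos t)%N.
Context (hf : fiber_eq w w') (hw1 : (0 < w z1)%N).
Context (hbefore : forall t, (0 < w t)%N -> (pos z1 <= pos t)%N).
Context (hafter : forall t, (0 < w' t)%N -> after t).

Definition has_xlinear_divisor w :=
  exists d, [/\ (d <= w)%MM, nonstandard d & (xdeg d <= 1)%N].

(* Induction hypothesis: a proper nonstandard divisor of [w] is enough. *)
Context (IH : forall d, (d <= w)%MM -> d <> w -> nonstandard d ->
  has_xlinear_divisor w).

(** No variable larger than [z1] occurs in [d] or [d'], and [z1] occurs in [d] only; hence [d'] is
    smaller than [d]. *)
Lemma nonstandard_after d d' : (d <= w)%MM -> (0 < d z1)%N ->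
  (forall t, (0 < d' t)%N -> after t) -> fiber_eq d d' -> nonstandard d.
Proof.
move=> /mnm_lepP hd h1 h' hfd; exists d' => //; apply: (@lex_lt_at _ _ _ _ z1).
  by case: (posnP (d' z1)) => [->|/h'] //; rewrite ltnn.
move=> t ht; case: (posnP (d' t)) => [->|/h']; last by rewrite ltnNge (ltnW ht).
case: (posnP (d t)) => [->|h] //.
have /hbefore : (0 < w t)%N by apply: leq_trans h (hd t).
by rewrite leqNgt ht.
Qed.

Lemma after_le b : (b <= w')%MM -> forall t, (0 < b t)%N -> after t.
Proof. by move=> /mnm_lepP h t hb; apply: hafter; apply: leq_trans hb (h t). Qed.

Lemma after_addU b z : (forall t, (0 < b t)%N -> after t) -> after z ->
  forall t, (0 < (b + U_(z))%MM t)%N -> after t.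
Proof.
move=> h hz t; rewrite mnmDE mnm1E addn_gt0 => /orP[/h//|].
by case: eqP => // <-.
Qed.

Lemma after_x i : after (lshift m i).
Proof. exact/key_pos/key_x. Qed.

(* The outcome at k of an alternating trail which avoids one copy of z1. *)
Definition good (k : 'I_n) := exists j r b,
  [/\ (x_ j + r + y_ j1 <= w)%MM, (b <= w')%MM, xdeg r = 0%N &
      fiber_eq (x_ j + r)%MM (x_ k + b)%MM].

Lemma good_x i : (0 < w (lshift m i))%N -> good i.
Proof.
move=> hi; exists i, 0%MM, 0%MM; split; rewrite ?xdeg0 //.
2: by apply/mnm_lepP => t; rewrite mnm0E.
rewrite addm0; apply: lepm_addU; last by rewrite mnm1E eq_lrshift.
by rewrite lep1mP -lt0n.
Qed.

(** Multiplying x_j r ~ x_k c by y_ab and regrouping the endpoints gives x_j r y_ab ~ x_b c y_ak.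
    The edge {a,k} only has to belong to I; it need not occur in [w']. *)
Lemma good_step (a b k : 'I_n) : u j1 = (U_(a) + U_(b))%MM -> good k ->
  edge a k -> (edge_key a b < edge_key a k)%N -> has_xlinear_divisor w.
Proof.
move=> hu1 [j [r [c [h1 h2 hr [hv hy]]]]] [l hl] hk.
exists (x_ j + r + y_ j1)%MM; split=> //; last by rewrite !degE hr.
apply: (@nonstandard_after _ (c + x_ b + y_ l)%MM) => //.
- by rewrite !mnmDE !mnm1E eqxx addn1.
- apply: after_addU; first by apply: after_addU (after_x b); apply: after_le.
  by apply: key_pos; rewrite (key_y hu1) (key_y hl).
- split=> [v|]; last by move: hy; rewrite !degE; lia.
  by move: (hv v); rewrite !degE hu1 hl !mnmDE !mnm1E; lia.
Qed.

Lemma incident_other j v : (0 < u j v)%N -> exists v', u j = (U_(v) + U_(v'))%MM.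
Proof. by case: (hquad j) => a [b ->]; apply: mnm_edge_other. Qed.

Lemma good_walk i k l : (0 < w (lshift m i))%N -> (0 < w' (rshift n l))%N ->
  u l = (U_(i) + U_(k))%MM -> has_xlinear_divisor w \/ good k.
Proof.
move=> hi hl hul.
(* State of the trail: it has arrived at v, having used r in w and b in w'. *)
suff walk N : forall v r b, (mdeg w - mdeg r <= N)%N -> (x_ i + r <= w)%MM ->
    r z1 = 0%N -> (y_ l + b <= w')%MM -> xdeg r = 0%N ->
    (forall t, (v == t) + vdeg r t = (k == t) + vdeg b t)%N -> ydeg r = ydeg b ->
    has_xlinear_divisor w \/ good k.
  apply: (walk _ k 0%MM 0%MM (leqnn _)); rewrite ?addm0 ?mnm0E ?degE // ?lep1mP -?lt0n //.
(* [r] grows inside [w] with each round. For [N = 0] no degree is left, although x_i r divides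
   [w]. *)
elim: N => [|N IHN] v r b hN hr hr1 hb hxr hv hy.
  exfalso; have /mnm_lepP := hr; move=> hle.
  have : (mdeg (x_ i + r)%MM <= mdeg w)%N by rewrite -(submK hr) [leqRHS]mdegD leq_addl.
  by rewrite mdegD mdeg1; lia.
have [|z hz [ez|[j ez huj]]] := @vdeg_lt _ _ u (x_ i + r)%MM w v hr.
- rewrite hf.1; have := lepm_vdeg u v hb; have := hv v.
  by rewrite !degE hul !mnmDE !mnm1E eqxx; lia.
- right; exists v, r, b; split=> //.
  + subst z; apply/mnm_lepP => t; move/mnm_lepP/(_ t): hz; rewrite !mnmDE !mnm1E.
    by case: (rshift n j1 =P t) => [<-|_]; rewrite ?hr1 ?eq_lrshift; lia.
  + by apply: lepm_trans hb; apply: lem_addl.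
  + by split=> [t|]; rewrite !degE ?hy // hv.
subst z; have [v' hv'] := incident_other huj.
case: (j =P j1) => [e|ne].
  (* The trail meets z1: cut it there and return to the extra vertex by x_v'. *)
  subst j; left; exists (x_ i + r + y_ j1)%MM; split=> //; last by rewrite !degE hxr.
  apply: (@nonstandard_after _ (y_ l + b + x_ v')%MM) => //.
  - by rewrite !mnmDE !mnm1E eqxx addn1.
  - by apply: after_addU (after_x v'); apply: after_le.
  - split=> [t|]; last by rewrite !degE hy; lia.
    by move: (hv t); rewrite !degE hv' hul !mnmDE !mnm1E; lia.
have hr2 : (x_ i + (r + y_ j) <= w)%MM by rewrite addmA.
(* The same count with the roles exchanged: x_i r y_j exceeds y_l b by one at v'. *)
have [|z hz2 [ez|[j' ez huj']]] := @vdeg_lt _ _ u (y_ l + b)%MM w' v' hb.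
- rewrite -hf.1; have := lepm_vdeg u v' hr2; have := hv v'.
  by rewrite !degE hul hv' !mnmDE !mnm1E eqxx; lia.
- (* The trail closes up without z1: divide it out. *)
  left; subst z; apply: (IH (lem_subr w (x_ i + (r + y_ j))%MM)).
    move=> /mnmP/(_ (lshift m i)); rewrite mnmBE !mnmDE !mnm1E eqxx.
    by move: hi; lia.
  apply: (@nonstandard_after _ (w' - (y_ l + b + x_ v'))%MM).
  + exact: lem_subr.
  + rewrite mnmBE !mnmDE !mnm1E hr1 eq_lrshift (inj_eq (@rshift_inj _ _)).
    by case: eqP => //; move: hw1; lia.
  + exact/after_le/lem_subr.
  + apply: fiber_sub => //; split=> [t|]; last by rewrite !degE hy; lia.
    by move: (hv t); rewrite !degE hv' hul !mnmDE !mnm1E; lia.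
subst z; have [v2 hv2] := incident_other huj'.
(* The trail continues from v2, with y_j and y_j' now used. *)
apply: (IHN v2 (r + y_ j)%MM (b + y_ j')%MM) => //.
- by rewrite mdegD mdeg1; lia.
- by rewrite mnmDE mnm1E hr1 (inj_eq (@rshift_inj _ _)); case: eqP.
- by rewrite addmA.
- by rewrite !degE hxr.
- by move=> t; move: (hv t); rewrite !degE hv' hv2 !mnmDE !mnm1E; lia.
- by rewrite !degE hy.
Qed.

Lemma after_key j : after (rshift n j) -> (key z1 <= key (rshift n j))%N.
Proof. by move=> /ltnW/key_s; rewrite !permKV. Qed.

(** Any edge {p,c} with c different from p comes after the loop [z1], so an edge of I joining p to i
    or k suffices. It is {i,k} itself if p is an endpoint; otherwise [star2] gives it if an endpoint
    exceeds p, and [star] if both are below p. A loop {i,i} with i < p would precede [z1]. *)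
Lemma step_loop p i k l : u j1 = (U_(p) + U_(p))%MM -> u l = (U_(i) + U_(k))%MM ->
  (0 < w' (rshift n l))%N -> good i -> good k -> has_xlinear_divisor w.
Proof.
move=> h1 hl hw gi gk.
have eik : edge i k by exists l.
have epp : edge p p by exists j1.
have hlk := after_key (hafter hw); rewrite (key_y h1) (key_y hl) in hlk.
have done c : good c -> c != p -> edge p c -> has_xlinear_divisor w.
  move=> gc hc e; apply: (good_step h1 gc e); apply: edge_key_loop_lt.
  by rewrite eq_sym.
case: (eqVneq i p) => [ei|ni].
  case: (eqVneq k p) => [ek|nk]; last by apply: (done k) => //; rewrite -ei.
  subst i k; move: (hafter hw).
  by rewrite (hinj (etrans hl (esym h1))) ltnn.
case: (eqVneq k p) => [ek|nk]; first by apply: (done i) => //; rewrite -ek; apply: edgeC.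
case: (ltngtP p i) => hpi.
- have [e|e] := star2 epp hpi (edgeC eik); first exact: (done i).
  exact: (done k).
- case: (ltngtP p k) => hpk.
  + have [e|e] := star2 epp hpk eik; first exact: (done k).
    exact: (done i).
  + have hik : i != k.
      apply/eqP => e; subst k; move: hlk; rewrite !edge_key_loop; lia.
    by have [e|e] := star hik hpi hpk eik; [apply: (done i)|apply: (done k)] => //; apply: edgeC.
  + by case/eqP: nk; apply: val_inj.
- by case/eqP: ni; apply: val_inj.
Qed.

(** Usable edges are {p,c} with c > q, and {q,c} with c > p and c different from q. Write {i,k} as
    {a,c} with a < c; the keys give p <= a. If c > q, apply [star] to {p,q} and c; if c < q, to
    {a,c} and q; if c = q, use {a,c} itself. *)
Lemma step_noloop (p q i k : 'I_n) l : (p < q)%N -> u j1 = (U_(p) + U_(q))%MM ->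
  u l = (U_(i) + U_(k))%MM ->
  (0 < w' (rshift n l))%N -> good i -> good k -> has_xlinear_divisor w.
Proof.
move=> hpq h1 hl hw gi gk.
have eik : edge i k by exists l.
have epq : edge p q by exists j1.
have npq : p != q by rewrite neq_ltn /= hpq.
have hlk := after_key (hafter hw); rewrite (key_y h1) (key_y hl) in hlk.
have nik : i != k.
  apply/eqP => e; subst k; move: hlk; rewrite leqNgt; case/negP.
  exact: edge_key_loop_lt.
have nsame : ~ (u l = u j1) by move/hinj => e; move: (hafter hw); rewrite e ltnn.
have doneq c : good c -> edge p c -> (q < c)%N -> has_xlinear_divisor w.
  move=> gc e hc; apply: (good_step h1 gc e); apply: edge_key_lt => //.
  by rewrite neq_ltn /=; lia.
have donep c : good c -> edge q c -> q != c -> (p < c)%N -> has_xlinear_divisor w.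
  move=> gc e hqc hc.
  apply: (good_step (a := q) (b := p) _ gc e); first by rewrite addmC.
  by apply: edge_key_lt => //; rewrite eq_sym.
(* Both endpoints are good, so they may be renamed to have [a < c]. *)
suff half a c : edge a c -> a != c -> good a -> good c -> (edge_key p q <= edge_key a c)%N ->
    (u l = U_(a) + U_(c))%MM -> (a < c)%N -> has_xlinear_divisor w.
  move: (nik); rewrite neq_ltn /= => /orP[h|h].
    exact: (half i k).
  apply: (half k i) => //; first exact: edgeC.
  - by rewrite eq_sym.
  - by rewrite [leqRHS]edge_keyC.
  - by rewrite addmC.
move=> eac nac ga gc hk hlac hac.
have [hpa hpa'] := edge_key_le hpq nac hk.
have hpc : (p < c)%N by apply: leq_ltn_trans hpa hac.
case: (ltngtP q c) => hqc.
- have [e|e] := star npq hpc hqc epq; first exact: (doneq c).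
  by apply: (donep c) => //; rewrite neq_ltn /= hqc.
- have [e|e] := star nac (ltn_trans hac hqc) hqc eac.
    apply: (donep a) => //; [exact: edgeC|by rewrite neq_ltn /=; lia|].
    rewrite ltn_neqAle hpa andbT; apply/eqP => epa.
    by have := hpa' (esym (val_inj epa)); lia.
  by apply: (donep c) => //; [exact: edgeC|by rewrite neq_ltn /=; lia].
- have ec : c = q by apply: val_inj.
  subst c; apply: (donep a) => //; [exact: edgeC|by rewrite eq_sym|].
  rewrite ltn_neqAle hpa andbT; apply/eqP => epa.
  by apply: nsame; rewrite hlac h1 (val_inj epa).
Qed.

(** Both ends of the edge {i,k} are good: i by the empty trail, k by [good_walk]. *)
Lemma step_x i l : (0 < w (lshift m i))%N -> (0 < w' (rshift n l))%N ->
  (0 < u l i)%N -> has_xlinear_divisor w.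
Proof.
move=> hi hl hu; have [k hk] := incident_other hu.
have [//|gk] := good_walk hi hl hk.
have gi := good_x hi; have [p [q hpq]] := hquad j1.
case: (ltngtP p q) => h.
- exact: (step_noloop h hpq hk hl).
- apply: (step_noloop (p := q) (q := p) h _ hk hl) => //; by rewrite addmC.
- by rewrite (val_inj h) in hpq; apply: (step_loop hpq hk hl).
Qed.
End Step.

Lemma nonstandard_xlinear_divisor w : nonstandard w -> has_xlinear_divisor w.
Proof.
elim: {w}(mdeg w) {-2}w (leqnn (mdeg w)) => [|N IHN] w hN.
  case=> w' _ [k [hk _]]; move: hN; rewrite leqn0 mdeg_eq0 => /eqP hw.
  by move: hk; rewrite hw mnm0E.
have IH d : (d <= w)%MM -> d <> w -> nonstandard d -> has_xlinear_divisor w.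
  move=> hd hne hns; have [|d' [h1 h2 h3]] := IHN d _ hns; last first.
    by exists d'; split=> //; apply: lepm_trans hd.
  have h := submK hd; rewrite -ltnS; apply: leq_trans hN; rewrite -h mdegD.
  rewrite -[X in (X < _)%N]add0n ltn_add2r lt0n mdeg_eq0; apply/eqP => e.
  by apply: hne; rewrite -h e add0m.
case=> w' hf hlt.
(* A common variable can be cancelled, which leaves a proper nonstandard divisor. Afterwards [w] and
   [w'] are coprime. *)
case: (boolP [exists t, (0 < w t)%N && (0 < w' t)%N]) => [/existsP[t /andP[h1 h2]]|].
  have h1' : (U_(t) <= w)%MM by rewrite lep1mP -lt0n.
  have h2' : (U_(t) <= w')%MM by rewrite lep1mP -lt0n.
  apply: (IH (w - U_(t))%MM); first exact: lem_subr.
    by move/mnmP/(_ t); rewrite mnmBE mnm1E eqxx; lia.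
  exists (w' - U_(t))%MM; first exact: fiber_sub.
  by apply: (proj1 (lex_lt_addr _ _ _ U_(t)%MM)); rewrite !submK.
rewrite negb_exists => /forallP hdis.
have {}hdis t : (0 < w t)%N -> w' t = 0%N.
  by move=> h; move: (hdis t); rewrite h /= -leqNgt leqn0 => /eqP.
case: hlt => k [hk hkb].
have hw1 : (0 < w (s k))%N by apply: leq_trans hk.
(* Before the first difference the exponents agree, and by coprimality they vanish. So [s k] is the
   largest variable of [w]. *)
have hzero t : (pos t < k)%N -> w t = 0%N /\ w' t = 0%N.
  move=> ht; have := hkb _ ht; rewrite permKV => e.
  by case: (posnP (w t)) => [h|/hdis h]; rewrite ?e ?h // -?e.
have hbefore t : (0 < w t)%N -> (pos (s k) <= pos t)%N.
  by rewrite permK => h; rewrite leqNgt; apply/negP => /hzero[e _]; rewrite e in h.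
have hafter t : (0 < w' t)%N -> (pos (s k) < pos t)%N.
  rewrite permK => h; rewrite ltn_neqAle leqNgt; apply/andP; split; last first.
    by apply/negP => /hzero[_ e]; rewrite e in h.
  by apply/eqP => /val_inj e; move: h; rewrite -[t](permKV s) -e (hdis _ hw1).
case: (leqP (xdeg w) 1) => hx; first by exists w; split=> //; [exact: lepm_refl|exists w' => //; exists k].
have [i hi] : exists i, (0 < w (lshift m i))%N.
  apply/existsP; move: hx; apply: contraLR; rewrite negb_exists => /forallP h.
  by rewrite /xdeg big1 // => i _; apply/eqP; rewrite -leqn0 leqNgt.
have incident i' : (0 < w (lshift m i'))%N ->
    exists2 l, (0 < w' (rshift n l))%N & (0 < u l i')%N.
  move=> h; have : (0 < vdeg w' i')%N by rewrite -hf.1; apply: leq_trans h (leq_addr _ _).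
  move=> /vdeg_gt0[z hz [ez|[l ez hl]]]; last by exists l => //; rewrite -ez.
  by move: hz; rewrite ez hdis.
(* [s k] is not some x_i': an edge of [w'] at i' would be a larger variable, while all of [w'] lies
   after [s k]. *)
case: (split_ordP (s k)) => [i' e|j1 e].
  have [|l hl _] := incident i'; first by rewrite -e.
  have /ltnW/key_s := hafter _ hl.
  by rewrite !permKV e leqNgt key_x.
have [l hl hul] := incident i hi; rewrite e in hw1 hbefore hafter.
exact: (step_x hf hw1 hbefore hafter IH hi hl hul).
Qed.
End Core.

(** * Totality of the lexicographic order and leading monomials *)

Lemma seq_greatest (T : eqType) (R : T -> T -> Prop) (L : seq T) (x0 : T) :
  (forall x y, R x y \/ R y x) -> (forall y x z, R x y -> R y z -> R x z) ->
  x0 \in L -> exists2 x, x \in L & forall y, y \in L -> R y x.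
Proof.
move=> tot tr; elim: L x0 => // a L IH x0 _.
have Ra x : R x x by case: (tot x x).
case: L IH => [|b L] IH; first by exists a; rewrite ?inE // => y; rewrite inE => /eqP ->.
have [|x hx hmax] := IH b; first by rewrite inE eqxx.
case: (tot a x) => hax.
  exists x; first by rewrite inE hx orbT.
  by move=> y; rewrite inE => /orP[/eqP ->|/hmax].
exists a; first by rewrite inE eqxx.
by move=> y; rewrite inE => /orP[/eqP ->|/hmax h] //; apply: tr hax.
Qed.

Section Lex.
Context (N : nat) (s : 'S_N).
Implicit Types a b c : 'X_{1..N}.

Lemma lex_lt_irr a : ~ lex_lt s a a.
Proof. by case=> k []; rewrite ltnn. Qed.

Lemma lex_lt_trans b a c : lex_lt s a b -> lex_lt s b c -> lex_lt s a c.
Proof.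
move=> [k [hk h]] [k' [hk' h']]; case: (ltngtP k k') => e.
- by exists k; rewrite -(h' _ e); split=> // l hl; rewrite h // h' // (ltn_trans hl).
- by exists k'; rewrite (h _ e); split=> // l hl; rewrite -h' // h // (ltn_trans hl).
- have {}e := val_inj e; subst k'; exists k; split; first exact: ltn_trans hk'.
  by move=> l hl; rewrite h // h'.
Qed.

Lemma lex_total a b : [\/ lex_lt s a b, a = b | lex_lt s b a].
Proof.
case: (pickP (fun k => a (s k) != b (s k))) => [k0 hk0|h]; last first.
  by apply: Or32; apply/mnmP => t; have /negbFE/eqP := h ((s^-1)%g t); rewrite permKV.
case: (@arg_minnP _ k0 (fun k => a (s k) != b (s k)) (fun k => k : nat) hk0) => k hk hmin.
have hb (l : 'I_N) : (l < k)%N -> a (s l) = b (s l).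
  by move=> hl; apply/eqP; apply: contraTT hl => /hmin; rewrite -leqNgt.
case: (ltngtP (a (s k)) (b (s k))) hk => // e _; [apply: Or31|apply: Or33]; exists k; split=> //.
by move=> l /hb.
Qed.

Lemma lex_le_total a b : lex_le s a b \/ lex_le s b a.
Proof. by case: (lex_total a b) => h; [left;right|left;left|right;right]. Qed.

Lemma lex_le_trans b a c : lex_le s a b -> lex_le s b c -> lex_le s a c.
Proof. by move=> [->//|h] [<-|h']; right => //; apply: lex_lt_trans h'. Qed.

Lemma lead_mon_exists (K : fieldType) (f : {mpoly K[N]}) : f != 0 ->
  exists a, is_lead_mon s f a.
Proof.
rewrite -msupp_eq0; case E : (msupp f) => [|x L] // _.
have [|x' hx' h] := @seq_greatest _ (lex_le s) (msupp f) x lex_le_total lex_le_trans.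
  by rewrite E inE eqxx.
by exists x'.
Qed.

Lemma lead_mon_uniq (K : fieldType) (f : {mpoly K[N]}) a b :
  is_lead_mon s f a -> is_lead_mon s f b -> a = b.
Proof.
move=> [ha hla] [hb hlb]; case: (hla _ hb) => // h; case: (hlb _ ha) => // h'.
by case: (@lex_lt_irr a); apply: lex_lt_trans h.
Qed.

End Lex.

(** * Dickson's lemma *)

Definition mnm_behead N (a : 'X_{1..N.+1}) : 'X_{1..N} :=
  [multinom a (lift ord0 i) | i < N].

Lemma lepm_behead N (a b : 'X_{1..N.+1}) :
  (a ord0 <= b ord0)%N -> (mnm_behead a <= mnm_behead b)%MM -> (a <= b)%MM.
Proof.
move=> h0 /mnm_lepP h; apply/mnm_lepP => i; case: (unliftP ord0 i) => [j|] -> //.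
by have := h j; rewrite !mnmE.
Qed.

Lemma seq_preimage (S T : eqType) (f : S -> T) (P : S -> Prop) (L : seq T) :
  (forall t, t \in L -> exists2 x, P x & f x = t) ->
  exists2 M : seq S, (forall x, x \in M -> P x) & L = map f M.
Proof.
elim: L => [|t L IH] h; first by exists [::].
have [|M hM ->] := IH; first by move=> x hx; apply: h; rewrite inE hx orbT.
have [|x hx <-] := h t; first by rewrite inE eqxx.
by exists (x :: M) => // y; rewrite inE => /orP[/eqP ->|/hM].
Qed.

(** Induction on the number of variables: each slice with fixed first exponent is handled by the
    induction hypothesis, and so is the projection forgetting that exponent, which bounds the slices
    to be considered. *)
Lemma dickson N (A : 'X_{1..N} -> Prop) : exists L : seq 'X_{1..N},
  (forall a, a \in L -> A a) /\ (forall a, A a -> exists2 l, l \in L & (l <= a)%MM).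
Proof.
elim: N A => [|N IH] A.
  case: (classic (exists a, A a)) => [[a ha]|h]; last first.
    by exists [::]; split=> // a ha; case: h; exists a.
  exists [:: a]; split=> [b|b _]; first by rewrite inE => /eqP ->.
  by exists a; rewrite ?inE //; apply/mnm_lepP => -[].
have slice k : exists M : seq 'X_{1..N.+1}, (forall a, a \in M -> A a) /\
    (forall a, A a -> a ord0 = k -> exists2 l, l \in M & (l <= a)%MM).
  have [L [hL hL']] := IH (fun t => exists2 a, A a /\ a ord0 = k & mnm_behead a = t).
  have [M hM eM] := seq_preimage hL; exists M; split=> [a /hM[]//|a ha hk].
  have [|t] := hL' (mnm_behead a); first by exists a.
  rewrite eM => /mapP[b hb ->] hba; exists b => //; apply: lepm_behead => //.
  by rewrite hk; case: (hM _ hb) => _ ->.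
have slices k : exists M : seq 'X_{1..N.+1}, (forall a, a \in M -> A a) /\
    (forall a, A a -> (a ord0 <= k)%N -> exists2 l, l \in M & (l <= a)%MM).
  elim: k => [|k [M [hM hM']]].
    have [M [hM hM']] := slice 0%N; exists M; split=> // a ha.
    by rewrite leqn0 => /eqP; apply: hM'.
  have [M1 [h1 h1']] := slice k.+1; exists (M ++ M1); split=> [a|a ha].
    by rewrite mem_cat => /orP[/hM|/h1].
  rewrite leq_eqVlt => /orP[/eqP e|e].
    by have [l hl hla] := h1' _ ha e; exists l => //; rewrite mem_cat hl orbT.
  by have [l hl hla] := hM' _ ha e; exists l => //; rewrite mem_cat hl.
have [L [hL hL']] := IH (fun t => exists2 a, A a & mnm_behead a = t).
have [M0 hM0 eM0] := seq_preimage hL.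
(* An element with first exponent above [k] is divisible by some element of [M0], which in turn is
   divisible by an element of [M]. *)
pose k := \max_(a <- M0) a ord0.
have [M [hM hM']] := slices k; exists M; split=> // a ha.
case: (leqP (a ord0) k) => hk; first exact: hM'.
have [|t] := hL' (mnm_behead a); first by exists a.
rewrite eM0 => /mapP[b hb ->] hba.
have hbk : (b ord0 <= k)%N by apply: leq_bigmax_seq.
have [l hl hlb] := hM' _ (hM0 _ hb) hbk.
exists l => //; apply: lepm_trans hlb _; apply: lepm_behead => //.
exact/ltnW/(leq_ltn_trans hbk).
Qed.

(** * Quadratic monomial ideals as graphs, and sorting of the variables *)

Lemma mcoeff_mulX (K : fieldType) N (p : {mpoly K[N]}) a b :
  (p * 'X_[a])@_b != 0 -> (a <= b)%MM.
Proof.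
rewrite -mcoeff_msupp (perm_mem (msuppMX _ _)) => /mapP[c _ ->].
exact: lem_addr.
Qed.

Lemma lepm_mdeg_eq N (a b : 'X_{1..N}) : (a <= b)%MM -> (mdeg b <= mdeg a)%N -> a = b.
Proof.
move=> h; rewrite -{1}(submK h) mdegD -{2}[mdeg a]add0n leq_add2r leqn0 mdeg_eq0.
by move=> /eqP e; rewrite -(submK h) e add0m.
Qed.

(** A monomial of the ideal is divisible by a generator, and equal degrees force equality. *)
Lemma in_monideal_edge (K : fieldType) n m (u : 'I_m -> 'X_{1..n}) (i j : 'I_n) :
  (forall l, mdeg (u l) = 2%N) ->
  @in_monideal K n m u ('X_i * 'X_j) <-> exists l, u l = (U_(i) + U_(j))%MM.
Proof.
move=> hdeg; rewrite -mpolyXD; split=> [[c hc]|[l hl]].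
  have : ('X_[U_(i) + U_(j)] : {mpoly K[n]})@_(U_(i) + U_(j)) != 0.
    by rewrite mcoeffX eqxx oner_neq0.
  rewrite {1}hc raddf_sum /= => h.
  have [l hl] : exists l, (c l * 'X_[u l])@_(U_(i) + U_(j)) != 0.
    apply/existsP; apply: contraNT h; rewrite negb_exists => /forallP h.
    by rewrite big1 // => l _; apply/eqP; move: (h l); rewrite negbK.
  exists l; apply: (lepm_mdeg_eq (mcoeff_mulX hl)).
  by rewrite mdegD !mdeg1 hdeg.
exists (fun k => (k == l)%:R); rewrite (bigD1 l) //= eqxx mul1r hl big1 ?addr0 //.
by move=> k /negbTE ->; rewrite mul0r.
Qed.

Lemma mdeg2P n (a : 'X_{1..n}) : mdeg a = 2%N -> exists p q, a = (U_(p) + U_(q))%MM.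
Proof.
move=> h; have [p hp] : exists p, a p != 0%N.
  apply/existsP; rewrite -negb_forall; apply/negP => /forallP e.
  by move: h; rewrite mdegE big1 // => i _; apply/eqP.
have hpa : (U_(p) <= a)%MM by rewrite lep1mP.
have /eqP/mdeg1P[q /eqP hq] : mdeg (a - U_(p))%MM = 1%N.
  by move: h; rewrite -{1}(submK hpa) mdegD mdeg1; lia.
by exists q, p; rewrite -hq submK.
Qed.

Lemma sorting_perm N (key : 'I_N -> nat) : exists s : 'S_N,
  forall k l : 'I_N, (k <= l)%N -> (key (s k) <= key (s l))%N.
Proof.
pose r := relpre key leq; pose L := sort r (enum 'I_N).
have hsz : size L = N by rewrite size_sort size_enum_ord.
have huniq : uniq L by rewrite sort_uniq enum_uniq.
pose f (k : 'I_N) := tnth (Tuple (introT eqP hsz)) k.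
have finj : injective f by apply/tuple_uniqP.
exists (perm finj) => k l hkl; rewrite !permE /f !(tnth_nth k) /=.
have hr : sorted r L by apply: sort_sorted => x y; apply: leq_total.
apply: (sorted_leq_nth (leT := r)) => //; rewrite ?inE ?hsz //.
- by move=> y x z; apply: leq_trans.
- by move=> x; apply: leqnn.
Qed.

(** * The reduced Groebner basis of the Rees kernel *)

Section Rees.
Context (K : fieldType) (n m : nat) (u : 'I_m -> 'X_{1..n}).
Implicit Types (w : 'X_{1..n + m}) (f : {mpoly K[n + m]}).

Definition image_mon w : 'X_{1..n.+1} :=
  [multinom if unlift ord_max i is Some v then vdeg u w v else ydeg w | i < n.+1].

Lemma image_mon_eq w w' : image_mon w = image_mon w' <-> fiber_eq u w w'.
Proof.
split=> [/mnmP h|[hv hy]].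
  split=> [v|]; first by have := h (lift ord_max v); rewrite !mnmE liftK.
  by have := h ord_max; rewrite !mnmE unlift_none.
by apply/mnmP => i; rewrite !mnmE; case: (unlift _ _).
Qed.

Lemma widen_lift (v : 'I_n) : widen_ord (leqnSn n) v = lift ord_max v.
Proof. by apply: val_inj; rewrite /= /bump leqNgt ltn_ord. Qed.

Lemma S_to_StX (a : 'X_{1..n}) : S_to_St ('X_[a] : {mpoly K[n]}) = 'X_[mnmwiden a].
Proof.
rewrite /S_to_St comp_mpolyX mpolyXE_id big_ord_recr /= mnmwiden_ordmax expr0 mulr1.
by apply: eq_bigr => i _; rewrite tnth_mktuple mnmwiden_widen.
Qed.

Lemma rees_phiX w : rees_phi u ('X_[w] : {mpoly K[n + m]}) = 'X_[image_mon w].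
Proof.
pose g (z : 'I_(n + m)) : 'X_{1..n.+1} := match split z with
  | inl a => U_(widen_ord (leqnSn n) a)%MM | inr b => (mnmwiden (u b) + U_(ord_max))%MM end.
rewrite /rees_phi comp_mpolyX.
rewrite (eq_bigr (fun z => 'X_[g z *+ w z])) => [|z _]; last first.
  rewrite tnth_mktuple -mpolyXn /rees_image /g; case: (split z) => // b.
  by rewrite S_to_StX mpolyXD.
rewrite -(big_morph _ (@mpolyXD _ _) (@mpolyX0 _ _)).
congr 'X_[_]; apply/mnmP => i; rewrite mnm_sumE big_split_ord /= mnmE.
have gl a : g (lshift m a) = U_(lift ord_max a)%MM.
  by rewrite /g -widen_lift (unsplitK (inl a)).
have gr b : g (rshift n b) = (mnmwiden (u b) + U_(ord_max))%MM.
  by rewrite /g (unsplitK (inr b)).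
case: (unliftP ord_max i) => [v ->|->].
  rewrite /vdeg (bigD1 v) //= mulmnE gl mnm1E eqxx mul1n big1 ?addn0; last first.
    move=> a ha; rewrite mulmnE gl mnm1E (inj_eq (@lift_inj _ _)).
    by rewrite (negbTE ha).
  congr (_ + _)%N; apply: eq_bigr => b _.
  rewrite mulmnE gr mnmDE mnm1E -widen_lift mnmwiden_widen mulnC widen_lift.
  by rewrite (negbTE (neq_lift _ _)) addn0.
rewrite big1 ?add0n => [|a _].
  apply: eq_bigr => b _.
  by rewrite mulmnE gr mnmDE mnm1E eqxx mnmwiden_ordmax mul1n.
by rewrite mulmnE gl mnm1E eq_sym (negbTE (neq_lift _ _)).
Qed.

Lemma rees_phiE f : rees_phi u f = \sum_(w <- msupp f) f@_w *: 'X_[image_mon w].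
Proof.
rewrite {1}[f]mpolyE /rees_phi raddf_sum /=; apply: eq_bigr => w _.
by rewrite comp_mpolyZ -rees_phiX.
Qed.

Context (s : 'S_(n + m)) (hdeg : forall j, mdeg (u j) = 2%N).
Local Notation nonstandard := (nonstandard u s).
Local Notation fiber_eq := (fiber_eq u).

(** The coefficient of phi(f) at the image of [b] vanishes, so a second monomial of f lies in the
    fibre of [b]; it is smaller because [b] leads. *)
Lemma lead_mon_nonstandard f b :
  rees_kernel u f -> is_lead_mon s f b -> nonstandard b.
Proof.
move=> hf [hb hlead]; apply: NNPP => hns.
have : (rees_phi u f)@_(image_mon b) = 0 by rewrite hf mcoeff0.
rewrite rees_phiE raddf_sum /= (bigD1_seq b) //= ?msupp_uniq // mcoeffZ mcoeffX eqxx mulr1.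
rewrite big_seq_cond big1 ?addr0.
  by move/eqP; rewrite mcoeff_eq0 hb.
move=> w /andP[hw hwb]; rewrite mcoeffZ mcoeffX; case: eqP => [e|_]; last by rewrite mulr0.
case: hns; exists w; first by have /image_mon_eq := esym e.
by case: (hlead _ hw) => // ewb; rewrite ewb eqxx in hwb.
Qed.

Lemma normal_form_exists w : exists w0, fiber_eq w w0 /\ ~ nonstandard w0.
Proof.
pose fiberb w' := [forall v, vdeg u w v == vdeg u w' v] && (ydeg w == ydeg w').
have fiberP w' : reflect (fiber_eq w w') (fiberb w').
  apply: (iffP andP) => [[/forallP h /eqP hy]|[h ->]]; split=> //.
    by move=> v; apply/eqP.
  by apply/forallP => v; rewrite h.
(* Degree is constant on the fibre, so it lies among the finitely many monomials of degree below
   [(mdeg w).+1]. *)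
pose F := [seq w' <- [seq val b | b <- bmnm_enum (n + m) (mdeg w).+1] | fiberb w'].
have FP w' : w' \in F <-> fiber_eq w w'.
  rewrite mem_filter; split=> [/andP[/fiberP]//|h].
  apply/andP; split; first exact/fiberP.
  have hb : (mdeg w' < (mdeg w).+1)%N by rewrite (fiber_mdeg hdeg h).
  apply/mapP; exists (BMultinom hb) => //.
  by rewrite -has_pred1 has_count bmnm_enumP.
have [|||w0 h0 hmin] := @seq_greatest _ (fun a b => lex_le s b a) F w.
- by move=> x y; apply: lex_le_total.
- by move=> y x z h1 h2; apply: lex_le_trans h2 h1.
- exact/FP.
exists w0; have h := proj1 (FP _) h0; split=> // -[w1 [hv hy] hlt].
case: (hmin w1) => [|e|hlt'].
- by apply/FP; case: h => h1 h2; split=> [v|]; rewrite ?h1 ?h2.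
- by rewrite e in hlt; apply: lex_lt_irr hlt.
- by apply: (@lex_lt_irr _ s w0); apply: lex_lt_trans hlt' hlt.
Qed.

Definition minimal_nonstandard w :=
  nonstandard w /\ forall d, (d <= w)%MM -> nonstandard d -> d = w.

Lemma minimal_nonstandard_exists w : nonstandard w ->
  exists2 d, minimal_nonstandard d & (d <= w)%MM.
Proof.
elim: {w}(mdeg w) {-2}w (leqnn (mdeg w)) => [|N IHN] w hN hw.
  exists w; last exact: lepm_refl.
  split=> // d hd _; apply: lepm_mdeg_eq => //; exact: leq_trans hN _.
case: (classic (exists d, [/\ (d <= w)%MM, nonstandard d & d <> w])) => [[d [h1 h2 h3]]|h].
  have [|d' hd' hle] := IHN d _ h2; last by exists d' => //; apply: lepm_trans h1.
  rewrite leqNgt; apply/negP => hlt; apply: h3; apply: lepm_mdeg_eq => //.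
  exact: leq_trans hN hlt.
exists w; last exact: lepm_refl.
by split=> // d hd hnd; apply: NNPP => hne; case: h; exists d.
Qed.

(** Dickson's lemma makes the set of minimal nonstandard monomials finite. In w - nf w the leading
    monomial w has no other nonstandard divisor by minimality, and the tail nf w has none because it
    is standard. *)
Lemma reduced_groebner_exists :
  exists G : seq {mpoly K[n + m]}, is_reduced_groebner s (@rees_kernel K n m u) G /\
    forall g, g \in G -> exists w w', [/\ minimal_nonstandard w, fiber_eq w w',
      is_binomial g & forall t, t \in msupp g -> t = w \/ t = w'].
Proof.
have [nf hnf] := functional_choice _ normal_form_exists.
have [L [hL hL']] := dickson minimal_nonstandard.
pose g w : {mpoly K[n + m]} := 'X_[w] - 'X_[nf w].
have neq_nf w : nonstandard w -> w != nf w.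
  by move=> hw; apply/eqP => e; case: (hnf w) => _; rewrite -e.
have gsupp w t : nonstandard w -> (t \in msupp (g w)) = (t \in [:: w; nf w]).
  move=> hw; rewrite mcoeff_msupp mcoeffB !mcoeffX !inE ![t == _]eq_sym.
  case: (w =P t) => [<-|_]; first by rewrite [nf w == w]eq_sym (negbTE (neq_nf _ hw)) subr0 oner_neq0.
  by rewrite sub0r oppr_eq0; case: (nf w =P t) => _; rewrite ?oner_neq0 ?eqxx.
have glead w : nonstandard w -> is_lead_mon s (g w) w.
  move=> hw; split=> [|t]; rewrite gsupp // !inE ?eqxx //.
  case/orP=> /eqP ->; [by left|right]; have [hf hst] := hnf w.
  case: (lex_total s (nf w) w) => // [e|hlt]; first by rewrite -{1}e in hw.
  by case: hst; exists w => //; case: hf => h1 h2; split.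
have Lns w : w \in L -> nonstandard w by move/hL => [].
exists [seq g w | w <- undup L]; split; last first.
  move=> f /mapP[w]; rewrite mem_undup => hw ->; exists w, (nf w); split.
  - exact: hL.
  - by case: (hnf w).
  - have hp : perm_eq (msupp (g w)) [:: w; nf w].
      apply: uniq_perm; first exact: msupp_uniq.
        by rewrite /= inE neq_nf //; apply: Lns.
      by move=> t; rewrite gsupp //; apply: Lns.
    by rewrite /is_binomial (perm_size hp).
  - move=> t; rewrite gsupp; last exact: Lns.
    by rewrite !inE => /orP[/eqP|/eqP]; [left|right].
split; [split|split; [|split]].
- move=> f /mapP[w]; rewrite mem_undup => /Lns hw ->; split.
    rewrite /rees_kernel /rees_phi raddfB /= -!/(rees_phi u _) !rees_phiX.
    by apply/eqP; rewrite subr_eq0; apply/eqP; congr 'X_[_]; apply/image_mon_eq; case: (hnf w).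
  by rewrite -msupp_eq0; have [h _] := glead _ hw; case: (msupp _) h.
- move=> f hf f0; have [b hb] := lead_mon_exists s f0.
  have [d hd hdb] := minimal_nonstandard_exists (lead_mon_nonstandard hf hb).
  have [l hl hld] := hL' _ hd; exists (g l); split; first by rewrite map_f ?mem_undup.
  exists l, b; split; [exact/glead/Lns|split=> //].
  exact/mnm_lepP/(lepm_trans hld).
- rewrite map_inj_in_uniq ?undup_uniq // => w w'; rewrite !mem_undup => hw hw' e.
  by apply: (lead_mon_uniq (glead _ (Lns _ hw))); rewrite e; apply/glead/Lns.
- move=> f /mapP[w]; rewrite mem_undup => /Lns hw ->; exists w; split; first exact: glead.
  by rewrite mcoeffB !mcoeffX eqxx eq_sym (negbTE (neq_nf _ hw)) subr0.
- move=> f f' /mapP[w]; rewrite mem_undup => hw -> /mapP[w']; rewrite mem_undup => hw' -> hne a ha.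
  have {ha}-> := lead_mon_uniq ha (glead _ (Lns _ hw')).
  move=> t; rewrite gsupp ?inE; last exact: Lns.
  case/orP=> /eqP -> /mnm_lepP hle.
    case: (hL _ hw) => _ hmin; move: hne.
    by rewrite (hmin _ hle (Lns _ hw')) eqxx.
  by case: (hnf w) => _; apply; apply: nonstandard_mul hle (Lns _ hw').
Qed.

End Rees.

(** * The order of the variables and the conclusion *)

Definition variable_key n m (a b : 'I_m -> 'I_n) (z : 'I_(n + m)) : nat :=
  match split z with inl _ => (n + n * n + n)%N | inr j => edge_key (a j) (b j) end.

(** The endpoints of an edge are determined up to exchange, so the key does not depend on the chosen
    [a] and [b]. *)
Lemma variable_key_y n m (u : 'I_m -> 'X_{1..n}) (a b : 'I_m -> 'I_n) j p q :
  (forall l, u l = (U_(a l) + U_(b l))%MM) -> u j = (U_(p) + U_(q))%MM ->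
  variable_key a b (rshift n j) = edge_key p q.
Proof.
move=> hu h; rewrite /variable_key (unsplitK (inr j)); move: h; rewrite hu.
move=> h; have := (mnmP _ _).1 h (a j); rewrite !mnmDE !mnm1E eqxx.
case: (p =P a j) => [e _|_].
  by move: h; rewrite e => /addmI/mnmP/(_ (b j)); rewrite !mnm1E eqxx; case: eqP => // ->.
case: (q =P a j) => [e _|_]; last by [].
move: h; rewrite e [(U_(p) + _)%MM]addmC => /addmI/mnmP/(_ (b j)).
by rewrite !mnm1E eqxx; case: eqP => // -> _; rewrite edge_keyC.
Qed.

(** Endpoints below [n] keep every edge key under [n + n * n + n], the common key of all x
    variables. *)
Lemma variable_key_x n m (a b : 'I_m -> 'I_n) i j :
  (variable_key a b (rshift n j) < variable_key a b (lshift m i))%N.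
Proof.
rewrite /variable_key (unsplitK (inr j)) (unsplitK (inl i)) /edge_key.
have := ltn_ord (a j); have := ltn_ord (b j); case: eqP => _ hb ha.
  by lia.
have : (minn (a j) (b j) * n <= n * n)%N by rewrite leq_mul2r geq_min (ltnW ha) orbT.
by have : (maxn (a j) (b j) < n)%N; [rewrite gtn_max ha hb | lia].
Qed.

Unset Implicit Arguments.

Theorem theorem3p1 (K : fieldType) (n m : nat) (u : 'I_m -> 'X_{1..n})
  (hdeg : forall j, mdeg (u j) = 2%N)
  (hinj : injective u)
  (hstar : forall i j k : 'I_n, i != j -> (i < k)%N -> (j < k)%N ->
      @in_monideal K n m u ('X_i * 'X_j) ->
      @in_monideal K n m u ('X_i * 'X_k) \/ @in_monideal K n m u ('X_j * 'X_k))
  (hstar2 : forall i j k : 'I_n, @in_monideal K n m u ('X_i ^+ 2) -> (i < j)%N ->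
      @in_monideal K n m u ('X_k * 'X_j) ->
      @in_monideal K n m u ('X_i * 'X_j) \/ @in_monideal K n m u ('X_i * 'X_k)) :
  exists (s : 'S_(n + m)) (G : seq {mpoly K[n + m]}),
    is_reduced_groebner s ((@rees_kernel K n m u)) G /\
    (forall f, f \in G -> is_binomial f /\ (deg_x f <= 1)%N).
Proof.
have hquad j := mdeg2P (hdeg j).
have [a /fin_all_exists[b hab]] := fin_all_exists hquad.
have [s hs] := sorting_perm (variable_key a b).
have hE i j := in_monideal_edge K i j hdeg.
have [G [hG hbin]] := reduced_groebner_exists K s hdeg.
exists s, G; split=> // g /hbin[w [w' [[hw hmin] hf hg hsupp]]]; split=> //.
have [|||d [hdw hd hx]] := nonstandard_xlinear_divisor (key := variable_key a b)
  hquad hinj _ (variable_key_x a b) hs _ _ hw.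
- by move=> j p q; apply: variable_key_y.
- by move=> i j k hij hik hjk /hE h; have [/hE|/hE] := hstar _ _ _ hij hik hjk h; [left|right].
- move=> i j k /hE; rewrite -expr2 => h hij /hE h'.
  by have [/hE|/hE] := hstar2 _ _ _ h hij h'; [left|right].
(* By minimality of [w], its divisor [d] of x-degree at most 1 is [w] itself. *)
rewrite (hmin _ hdw hd) in hx.
apply/bigmax_leqP_seq => t /hsupp[->|->] _ //.
(* The tail lies in the same fibre, hence has the same x-degree. *)
by move: hx; rewrite (fiber_xdeg hdeg hf).
Qed.
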